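(* Let $p$ be a prime and let $c\ge 2$ be an integer prime to $p$. Let $r\ge1$, $(l_i)_r=(l_1,\ldots,l_r)\in\mathbb{N}_0^r$, $(\epsilon_i)_r=(\epsilon_1,\ldots,\epsilon_r)\in(\mu_c\setminus\{1\})^r$, $(\kappa_i)_{r-1}=(\kappa_1,\ldots,\kappa_{r-1})\in\mathbb{N}_0^{r-1}$, and set $\kappa_0=0$. Then for every $\xi\in\mu_c$, $$\begin{aligned} \mathcal{B}_{0,\xi}^{((l_i)_r;(\epsilon_i)_r;(\kappa_i)_{r-1})}=\ &\sum_{(e_i)_r\in\{0\}\times\{0,1\}^{r-1}}\ \sum_{i_1=0}^{1-e_1}\cdots\sum_{i_r=0}^{1-e_r}(-1)^{\sum_{k=1}^r(e_k+i_k)}\\ &\times\mathfrak{B}_{(l_1\circ_{e_2}\cdots\circ_{e_r}l_r)}\left(\epsilon_1^{-1}(1-e_1)\circ_{e_2}\cdots\circ_{e_r}\epsilon_r^{-1}(1-e_r)\right)\ \delta_{\xi,\prod_{k=1}^r\epsilon_k^{-(\kappa_{k-1}+i_k)}}. \end{aligned}$$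
   Context: $\mathbb{N}=\{1,2,\ldots\}$, $\mathbb{N}_0=\mathbb{N}\cup\{0\}$; $\mu_c$ is the group of $c$-th roots of unity; $\delta_{a,b}$ is the Kronecker delta; $0^0=1$. Twisted multiple Bernoulli numbers (TMBNs). For $s\in\mathbb{N}$ and roots of unity $\xi_1,\ldots,\xi_s\ne 1$, the numbers $\mathfrak{B}_{(n_1,\ldots,n_s)}(\xi_1,\ldots,\xi_s)$, $(n_j)\in\mathbb{N}_0^s$, are defined by $$\prod_{j=1}^s\frac{1}{1-\xi_j\exp\left(\sum_{k=j}^s t_k\right)}=\sum_{n_1,\ldots,n_s\ge 0}\mathfrak{B}_{(n_1,\ldots,n_s)}(\xi_1,\ldots,\xi_s)\frac{t_1^{n_1}}{n_1!}\cdots\frac{t_s^{n_s}}{n_s!}.$$ Convention for $\circ$: $\circ_0$ is read as a comma and $\circ_1$ as $+$. So for $(e_1,\ldots,e_r)\in\{0\}\times\{0,1\}^{r-1}$, the expression $a_1\circ_{e_2}a_2\circ_{e_3}\cdots\circ_{e_r}a_r$ denotes the tuple of length $r-\sum_k e_k$ obtained by cutting $(a_1,\ldots,a_r)$ into consecutive blocks, a new block starting at each index $k$ with $e_k=0$, and summing the entries in each block. In particular $\epsilon_1^{-1}(1-e_1)\circ_{e_2}\cdots\circ_{e_r}\epsilon_r^{-1}(1-e_r)$ is the tuple $(\epsilon_k^{-1})_{k:\,e_k=0}$. Cyclotomic multiple Bernoulli numbers (CMBNs). For $h\in\mathbb{N}$ put $$\mathcal{S}_{(\kappa_i)_{r-1},h}((l_i)_r;(\epsilon_i)_r)=\sum_{(u_1,\ldots,u_r)}\left(\frac{\epsilon_2}{\epsilon_1}\right)^{u_1}\cdots\left(\frac{\epsilon_r}{\epsilon_{r-1}}\right)^{u_{r-1}}\left(\frac{1}{\epsilon_r}\right)^{u_r}u_1^{l_1}\cdots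 u_r^{l_r},$$ the sum being over $(u_1,\ldots,u_r)\in\mathbb{N}_0^r$ with $u_1<h$ and $u_{i-1}+\kappa_{i-1}h<u_i<u_{i-1}+(\kappa_{i-1}+1)h$ for all $2\le i\le r$. The CMBNs $\mathcal{B}_{l,\xi}^{((l_i)_r;(\epsilon_i)_r;(\kappa_i)_{r-1})}\in\mathbb{Q}(\mu_c)$, for $l\in\{0,\ldots,l_1+\cdots+l_r+r\}$ and $\xi\in\mu_c$, are the (unique) elements such that for all $h\in\mathbb{N}$ $$\mathcal{S}_{(\kappa_i)_{r-1},h}((l_i)_r;(\epsilon_i)_r)=\sum_{\substack{0\le l\le l_1+\cdots+l_r+r\\ \xi\in\mu_c}}\mathcal{B}_{l,\xi}^{((l_i)_r;(\epsilon_i)_r;(\kappa_i)_{r-1})}\,h^l\,\xi^h.$$ *)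

(* Defs.v *)
From HB Require Import structures.
From mathcomp Require Import all_boot all_order all_algebra all_field.
From mathcomp Require Import boolp.
From mathcomp Require Import mpoly.
Set Implicit Arguments.
Unset Strict Implicit.
Unset Printing Implicit Defensive.
Import Order.TTheory GRing.Theory Num.Theory.
Local Open Scope ring_scope.

(** * Formal power series in [n] commuting variables *)

Record mfps (n : nat) (R : Type) := MFps { mfcoef : 'X_{1..n} -> R }.

Lemma mfpsP n R (f g : mfps n R) :
  (forall m, mfcoef f m = mfcoef g m) -> f = g.
Proof. by case: f g => [f] [g] /= /funext ->. Qed.

HB.instance Definition _ n R := gen_eqMixin (mfps n R).
HB.instance Definition _ n R := gen_choiceMixin (mfps n R).

Section MFpsRing.
Variables (n : nat) (R : comUnitRingType).
Implicit Types (f g h : mfps n R) (m : 'X_{1..n}) (d : nat).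

Definition mfpsC (a : R) : mfps n R := MFps (fun m => (m == 0%MM)%:R * a).
Definition mfpsX (i : 'I_n) : mfps n R := MFps (fun m => (m == U_(i)%MM)%:R).

Definition mfps_opp f : mfps n R := MFps (fun m => - mfcoef f m).
Definition mfps_add f g : mfps n R := MFps (fun m => mfcoef f m + mfcoef g m).
Definition mfps_mul f g : mfps n R := MFps (fun m =>
  \sum_(k : 'X_{1..n < (mdeg m).+1, (mdeg m).+1} | m == (k.1 + k.2)%MM)
     mfcoef f k.1 * mfcoef g k.2).

Fact mfps_addA : associative mfps_add.
Proof. by move=> f g h; apply: mfpsP => m /=; rewrite addrA. Qed.
Fact mfps_addC : commutative mfps_add.
Proof. by move=> f g; apply: mfpsP => m /=; rewrite addrC. Qed.
Fact mfps_add0 : left_id (mfpsC 0) mfps_add.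
Proof. by move=> f; apply: mfpsP => m /=; rewrite mulr0 add0r. Qed.
Fact mfps_addN : left_inverse (mfpsC 0) mfps_opp mfps_add.
Proof. by move=> f; apply: mfpsP => m /=; rewrite addNr mulr0. Qed.

HB.instance Definition _ := GRing.isZmodule.Build (mfps n R)
  mfps_addA mfps_addC mfps_add0 mfps_addN.

(* The polynomial truncation in total degree < d; it transfers the ring laws
   of {mpoly R[n]} to power series. *)
Definition mfps_trunc d f : {mpoly R[n]} :=
  \sum_(k : 'X_{1..n < d}) mfcoef f k *: 'X_[k].

Lemma mcoeff_trunc d f m :
  (mdeg m < d)%N -> (mfps_trunc d f)@_m = mfcoef f m.
Proof.
move=> md; rewrite /mfps_trunc raddf_sum /= (bigD1 (BMultinom md)) //=.
rewrite mcoeffZ mcoeffX eqxx mulr1 big1 ?addr0 // => k ne.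
rewrite mcoeffZ mcoeffX; case: eqP => [e|]; last by rewrite mulr0.
by case/eqP: ne; apply: val_inj.
Qed.

Lemma mcoeffM_eq (p p' q q' : {mpoly R[n]}) m :
  (forall k, (mdeg k <= mdeg m)%N -> p@_k = p'@_k) ->
  (forall k, (mdeg k <= mdeg m)%N -> q@_k = q'@_k) ->
  (p * q)@_m = (p' * q')@_m.
Proof.
move=> ep eq; rewrite !mcoeffM; apply: eq_bigr => k _.
by rewrite ep ?eq // -ltnS bmdeg.
Qed.

Lemma mfps_mulE d f g m : (mdeg m < d)%N ->
  mfcoef (mfps_mul f g) m = (mfps_trunc d f * mfps_trunc d g)@_m.
Proof.
move=> md; rewrite mcoeffM /=; apply: eq_bigr => k _.
by rewrite !mcoeff_trunc //; apply: leq_ltn_trans md; rewrite -ltnS bmdeg.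
Qed.

Lemma mfps_truncM d f g m : (mdeg m < d)%N ->
  (mfps_trunc d (mfps_mul f g))@_m = (mfps_trunc d f * mfps_trunc d g)@_m.
Proof. by move=> md; rewrite mcoeff_trunc // (mfps_mulE _ _ md). Qed.

Lemma mfps_truncC d a m : (mdeg m < d)%N ->
  (mfps_trunc d (mfpsC a))@_m = (a%:MP)@_m.
Proof. by move=> md; rewrite mcoeff_trunc //= mcoeffC eq_sym mulrC. Qed.

Fact mfps_mulA : associative mfps_mul.
Proof.
move=> f g h; apply: mfpsP => m; have md := ltnSn (mdeg m).
rewrite !(mfps_mulE _ _ md).
have -> : (mfps_trunc (mdeg m).+1 f
             * mfps_trunc (mdeg m).+1 (mfps_mul g h))@_m
  = (mfps_trunc (mdeg m).+1 f
      * (mfps_trunc (mdeg m).+1 g * mfps_trunc (mdeg m).+1 h))@_m.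
  by apply: mcoeffM_eq => // k km; rewrite mfps_truncM.
rewrite mulrA; apply: mcoeffM_eq => // k km.
by rewrite mfps_truncM.
Qed.

Fact mfps_mulC : commutative mfps_mul.
Proof.
move=> f g; apply: mfpsP => m; have md := ltnSn (mdeg m).
by rewrite !(mfps_mulE _ _ md) mulrC.
Qed.

Fact mfps_mul1 : left_id (mfpsC 1) mfps_mul.
Proof.
move=> f; apply: mfpsP => m; have md := ltnSn (mdeg m).
rewrite (mfps_mulE _ _ md) -(mcoeff_trunc f md) -[in RHS](mul1r (mfps_trunc _ f)).
by apply: mcoeffM_eq => // k km; rewrite mfps_truncC // mpolyC1.
Qed.

Fact mfps_mulDl : left_distributive mfps_mul mfps_add.
Proof.
move=> f g h; apply: mfpsP => m /=; rewrite -big_split /=.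
by apply: eq_bigr => k _; rewrite mulrDl.
Qed.

Fact mfps_oner_neq0 : mfpsC 1 != 0.
Proof.
apply/eqP => /(congr1 (fun f => mfcoef f 0%MM)) /=.
by rewrite eqxx mulr1 mulr0 => /eqP; rewrite oner_eq0.
Qed.

HB.instance Definition _ := GRing.Zmodule_isComNzRing.Build (mfps n R)
  mfps_mulA mfps_mulC mfps_mul1 mfps_mulDl mfps_oner_neq0.

Lemma mfcoef0 m : mfcoef (0 : mfps n R) m = 0.
Proof. by rewrite /= mulr0. Qed.

Lemma mfcoef1 m : mfcoef (1 : mfps n R) m = (m == 0%MM)%:R.
Proof. by rewrite /= mulr1. Qed.

Lemma mfcoefD f g m : mfcoef (f + g) m = mfcoef f m + mfcoef g m.
Proof. by []. Qed.

Lemma mfcoefN f m : mfcoef (- f) m = - mfcoef f m.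
Proof. by []. Qed.

Lemma mfcoefM f g m : mfcoef (f * g) m =
  \sum_(k : 'X_{1..n < (mdeg m).+1, (mdeg m).+1} | m == (k.1 + k.2)%MM)
     mfcoef f k.1 * mfcoef g k.2.
Proof. by []. Qed.

Lemma mfcoef_sum (I : Type) (r : seq I) (P : pred I) (F : I -> mfps n R) m :
  mfcoef (\sum_(i <- r | P i) F i) m = \sum_(i <- r | P i) mfcoef (F i) m.
Proof.
apply: (big_morph (fun f => mfcoef f m)) => [f g|]; first exact: mfcoefD.
exact: mfcoef0.
Qed.

Lemma mfcoefM_eq f f' g g' m :
  (forall k, (mdeg k <= mdeg m)%N -> mfcoef f k = mfcoef f' k) ->
  (forall k, (mdeg k <= mdeg m)%N -> mfcoef g k = mfcoef g' k) ->
  mfcoef (f * g) m = mfcoef (f' * g') m.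
Proof.
move=> ef eg; rewrite !mfcoefM; apply: eq_bigr => k _.
by rewrite ef ?eg // -ltnS bmdeg.
Qed.

Lemma mfcoefCM a g m : mfcoef (mfpsC a * g) m = a * mfcoef g m.
Proof.
have md := ltnSn (mdeg m); rewrite [LHS](mfps_mulE _ _ md).
rewrite -(mcoeff_trunc g md) -mcoeffCM; apply: mcoeffM_eq => // k km.
by rewrite mfps_truncC.
Qed.

Lemma mfcoef0M f g : mfcoef (f * g) 0%MM = mfcoef f 0%MM * mfcoef g 0%MM.
Proof.
have md : (mdeg (0%MM : 'X_{1..n}) < 1)%N by rewrite mdeg0.
by rewrite [LHS](mfps_mulE _ _ md) rmorphM /= !mcoeff_trunc.
Qed.

(* A series without constant term has k-th power of order at least k. *)
Lemma mfcoefX_lt f k m :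
  mfcoef f 0%MM = 0 -> (mdeg m < k)%N -> mfcoef (f ^+ k) m = 0.
Proof.
move=> f0; elim: k m => // k IH m mk; rewrite exprS mfcoefM big1 // => x /eqP e.
have [/eqP|x1] := eqVneq (mdeg x.1) 0%N.
  by rewrite mdeg_eq0 => /eqP ->; rewrite f0 mul0r.
have le : (mdeg m <= k)%N by [].
rewrite IH ?mulr0 //; apply: leq_trans le.
by rewrite [X in (_ < mdeg X)%N]e mdegD -[X in (X < _)%N]add0n ltn_add2r lt0n.
Qed.

(* A series with invertible constant term a is inverted by the geometric series
   a^-1 * \sum_k (1 - a^-1 f)^k; only the terms with k <= mdeg m contribute to
   the coefficient of index m. *)
Definition mfps_unit : pred (mfps n R) :=
  fun f => mfcoef f 0%MM \is a GRing.unit.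
Definition mfps_geom f : mfps n R :=
  MFps (fun m => \sum_(k < (mdeg m).+1) mfcoef (f ^+ k) m).
Definition mfps_inv f : mfps n R :=
  if mfps_unit f then
    mfpsC (mfcoef f 0%MM)^-1 * mfps_geom (1 - mfpsC (mfcoef f 0%MM)^-1 * f)
  else f.

Lemma mfps_geomE f d m : mfcoef f 0%MM = 0 -> (mdeg m < d)%N ->
  mfcoef (mfps_geom f) m = mfcoef (\sum_(k < d) f ^+ k) m.
Proof.
move=> f0 md; rewrite mfcoef_sum /= [LHS](big_ord_widen _ (fun k => mfcoef (f ^+ k) m) md).
rewrite big_mkcond /=; apply: eq_bigr => k _; case: ifPn => //.
by rewrite -leqNgt => km; rewrite mfcoefX_lt.
Qed.

Fact mfps_mulVr : {in mfps_unit, left_inverse 1 mfps_inv *%R}.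
Proof.
move=> f uf; have {}uf : mfps_unit f by [].
rewrite /mfps_inv uf; rewrite /mfps_unit in uf; set a := mfcoef f _ in uf *; set g := 1 - _.
have g0 : mfcoef g 0%MM = 0.
  by rewrite /g mfcoefD mfcoefN mfcoef1 mfcoefCM eqxx mulVr ?subrr.
have -> : mfpsC a^-1 * mfps_geom g * f = (1 - g) * mfps_geom g.
  by rewrite /g subKr mulrAC.
apply: mfpsP => m; have md := ltnSn (mdeg m).
rewrite (@mfcoefM_eq _ (1 - g) _ (\sum_(k < (mdeg m).+1) g ^+ k)) //; last first.
  by move=> k km; apply: mfps_geomE.
have -> : (1 - g) * (\sum_(k < (mdeg m).+1) g ^+ k) = 1 - g ^+ (mdeg m).+1.
  by rewrite -[X in _ = X - _](expr1n _ (mdeg m).+1) subrXX;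
     congr (_ * _); apply: eq_bigr => k _; rewrite expr1n mul1r.
by rewrite mfcoefD mfcoefN mfcoefX_lt // subr0.
Qed.

Fact mfps_unitPl f g : g * f = 1 -> mfps_unit f.
Proof.
move/(congr1 (fun f => mfcoef f 0%MM)); rewrite mfcoef0M mfcoef1 eqxx => e.
by apply/unitrPr; exists (mfcoef g 0%MM); rewrite mulrC.
Qed.

Fact mfps_inv_out : {in [predC mfps_unit], mfps_inv =1 id}.
Proof.
by move=> f nuf; have {}nuf : ~~ mfps_unit f by []; rewrite /mfps_inv (negbTE nuf).
Qed.

HB.instance Definition _ := GRing.ComNzRing_hasMulInverse.Build (mfps n R)
  mfps_mulVr mfps_unitPl mfps_inv_out.

(* exp f = \sum_k f^k / k!, for f without constant term: only the terms with
   k <= mdeg m contribute to the coefficient of index m. *)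
Definition mfps_exp f : mfps n R :=
  MFps (fun m => \sum_(k < (mdeg m).+1) (k`!%:R)^-1 * mfcoef (f ^+ k) m).

End MFpsRing.

(** * Twisted multiple Bernoulli numbers *)

Definition TMBN_gen (xs : seq algC) : mfps (size xs) algC :=
  \prod_(j < size xs)
    (1 - mfpsC _ xs`_j
           * mfps_exp (\sum_(k < size xs | (j <= k)%N) mfpsX _ k))^-1.

(* [ns] is meant to have the length of [xs], and the entries of [xs] to be
   roots of unity different from 1, so that every factor of [TMBN_gen xs] is
   the inverse of an invertible series. *)
Definition TMBN (ns : seq nat) (xs : seq algC) : algC :=
  (\prod_(j < size xs) (nth 0%N ns j)`!)%:R
    * mfcoef (TMBN_gen xs) [multinom nth 0%N ns j | j < size xs].

(* a_1 o_{e_2} a_2 o_{e_3} ... o_{e_r} a_r, where [true] stands for 1; the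
   entry e_1 is not used. *)
Fixpoint ocirc_from (V : nmodType) (acc : V) (e : seq bool) (a : seq V) :
    seq V :=
  match e, a with
  | ek :: e', ak :: a' =>
      if ek then ocirc_from (acc + ak) e' a' else acc :: ocirc_from ak e' a'
  | _, _ => [:: acc]
  end.
Definition ocirc (V : nmodType) (e : seq bool) (a : seq V) : seq V :=
  match e, a with
  | _ :: e', a1 :: a' => ocirc_from a1 e' a'
  | _, _ => [::]
  end.

(** * Cyclotomic multiple Bernoulli numbers *)

Definition mu (c : nat) : seq algC :=
  sval (closed_field_poly_normal ('X^c - 1 : {poly algC})).

Lemma mem_mu c x : (0 < c)%N -> (x \in mu c) = c.-unity_root x.
Proof.
move=> c0; rewrite /mu; case: closed_field_poly_normal => s /= es.
rewrite unity_rootE -[X in _ = X]/(_ == _) -subr_eq0.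
have -> : x ^+ c - 1 = ('X^c - 1).[x] by rewrite !hornerE.
rewrite -[X in _ = X]/(root _ x) es.
by rewrite (monicP (monicXnsubC 1 c0)) scale1r root_prod_XsubC.
Qed.

Lemma mu_uniq c : (0 < c)%N -> uniq (mu c).
Proof.
move=> c0; rewrite /mu; case: closed_field_poly_normal => s /= es.
rewrite -separable_prod_XsubC.
have <- : 'X^c - 1 = \prod_(z <- s) ('X - z%:P) :> {poly algC}.
  by rewrite {1}es (monicP (monicXnsubC 1 c0)) scale1r.
by apply: separable_Xn_sub_1; rewrite pnatr_eq0 -lt0n.
Qed.

(* Q(mu_c), as the intersection of the subfields containing mu_c. *)
Definition in_Qmu (c : nat) (x : algC) : Prop :=
  forall K : {pred algC},
    GRing.divring_closed K -> {subset mu c <= K} -> x \in K.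

Definition harm_dom (kappa : seq nat) (h : nat) (u : seq nat) : bool :=
  (nth 0%N u 0 < h)%N &&
  all (fun i => (nth 0%N u i + nth 0%N kappa i * h < nth 0%N u i.+1)%N
             && (nth 0%N u i.+1 < nth 0%N u i + (nth 0%N kappa i).+1 * h)%N)
      (iota 0 (size u).-1).

Definition harm_term (l : seq nat) (eps : seq algC) (u : seq nat) : algC :=
  (\prod_(i < (size u).-1) (eps`_i.+1 / eps`_i) ^+ nth 0%N u i)
    * (1 / eps`_(size u).-1) ^+ nth 0%N u (size u).-1
    * \prod_(i < size u) ((nth 0%N u i)%:R ^+ nth 0%N l i).

Definition harm_bound (r : nat) (kappa : seq nat) (h : nat) : nat :=
  (h * (r + sumn kappa))%N.

Definition harm_sum (r : nat) (l : r.-tuple nat) (eps : r.-tuple algC)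
    (kappa : r.-1.-tuple nat) (h : nat) : algC :=
  \sum_(u : r.-tuple 'I_(harm_bound r kappa h) | harm_dom kappa h (map val u))
    harm_term l eps (map val u).

(* The bound on the entries in [harm_sum] loses no summand. *)
Lemma harm_domP r (kappa : r.-1.-tuple nat) h (u : r.-tuple nat) :
  harm_dom kappa h u -> all (fun x => x < harm_bound r kappa h)%N u.
Proof.
case/andP=> u0 /allP uS; rewrite size_tuple in uS.
have H i : (i < r)%N -> (nth 0%N u i < h * (i.+1 + sumn (take i kappa)))%N.
  elim: i => [|i IH] ir; first by rewrite take0 addn0 muln1.
  have ir1 : (i < r.-1)%N by rewrite -ltnS (ltn_predK ir).
  have /andP[_ lt] : (nth 0%N u i + nth 0%N kappa i * h < nth 0%N u i.+1)%N
             && (nth 0%N u i.+1 < nth 0%N u i + (nth 0%N kappa i).+1 * h)%N.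
    by apply: uS; rewrite mem_iota.
  rewrite (take_nth 0%N) ?size_tuple // sumn_rcons.
  apply: leq_trans lt _.
  have -> : (h * (i.+2 + (sumn (take i kappa) + nth 0%N kappa i))
    = h * (i.+1 + sumn (take i kappa)) + (nth 0%N kappa i).+1 * h)%N.
    rewrite [((nth _ _ _).+1 * h)%N]mulnC -mulnDr; congr (h * _)%N.
    by rewrite addnS !addnA addSn.
  by rewrite leq_add2r ltnW // IH // ltnW.
apply/(all_nthP 0%N) => i; rewrite size_tuple => ir.
apply: leq_trans (H i ir) _; rewrite /harm_bound leq_mul2l; apply/orP; right.
by rewrite leq_add // -{2}(cat_take_drop i kappa) sumn_cat leq_addr.
Qed.

Definition is_CMBN (c r : nat) (l : r.-tuple nat) (eps : r.-tuple algC)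
    (kappa : r.-1.-tuple nat) (B : nat -> algC -> algC) : Prop :=
  (forall j xi, (j <= sumn l + r)%N -> xi \in mu c -> in_Qmu c (B j xi)) /\
  (forall h : nat, (0 < h)%N ->
     harm_sum l eps kappa h =
     \sum_(0 <= j < (sumn l + r).+1) \sum_(xi <- mu c)
        B j xi * h%:R ^+ j * xi ^+ h).

(* [CMBN c l eps kappa j xi] is B_{j,xi}^{(l; eps; kappa)}, which the property
   [is_CMBN] determines for j <= sumn l + r and xi in mu c. *)
Definition CMBN (c r : nat) (l : r.-tuple nat) (eps : r.-tuple algC)
    (kappa : r.-1.-tuple nat) : nat -> algC -> algC :=
  if pselect (exists B, is_CMBN c l eps kappa B) is left ex
  then projT1 (cid ex) else fun _ _ => 0.

(* Main.v *)
Require Import Defs.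
From HB Require Import structures.
From mathcomp Require Import all_boot all_order all_algebra all_field.
From mathcomp Require Import boolp ring.
From mathcomp Require Import mpoly.
Set Implicit Arguments.
Unset Strict Implicit.
Unset Printing Implicit Defensive.
Import Order.TTheory GRing.Theory Num.Theory.
Local Open Scope ring_scope.

(** Put [x_k = eps_k^-1] and let the gap variables be [y_1 = u_1] and
    [y_k = u_k - u_(k-1)].  The weight of a summand is then the product of the
    [x_k ^ y_k], so the harmonic sum is an iterated sum over gaps, the [k]-th
    gap running over [kappa_(k-1) h < y < (kappa_(k-1) + 1) h], with the value
    [y = 0] also allowed for the first one.

    Everything rests on one operator on univariate polynomials.  Let [S] be the
    translation [f(a) |-> f(a + 1)].  For [x <> 1] the operator [1 - x S] is
    invertible on polynomials, because [S - 1] lowers the degree; write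
    [G_x] for its inverse.  Telescoping ([geom_sum]) gives
      [sum_(0 <= y < h) x^y f(b + y) = (G_x f)(b) - x^h (G_x f)(b + h)].
    Hence a sum over an open gap is made of three terms ([gap_geom_sum]): the
    two end points of the telescoping sum, and the value at [y = kappa h] that
    the strict inequality removes.  They are the choices [(e, i) = (0, 0)],
    [(0, 1)] and [(1, 0)] of the theorem.  Expanding all the gap sums
    ([harm_sum_branch]) writes the harmonic sum as a signed sum over [(e, i)] of
      [(prod_k x_k^(kappa_(k-1) + i_k))^h * (branch e i h)(0)],
    where [branch e i h] is obtained from the constant 1 by alternately
    multiplying by ['X^l_k], applying [G_(x_k)] if [e_k = 0], and translating by
    [(kappa_(k-1) + i_k) h].

    For fixed [(e, i)] the value [(branch e i h)(0)] is a polynomial in [h] of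
    degree at most [l_1 + .. + l_r] with coefficients in Q(mu_c)
    ([polyfam_branch], [polyfam_value0]).  Since the coefficients of a
    quasi-polynomial are unique ([quasi_poly_eq0]), the number of index
    [(0, xi)] is the signed sum of the values [(branch e i 0)(0)] over the
    [(e, i)] whose root of unity is [xi] ([CMBN0E]).

    At [h = 0] the translations disappear.  A position with [e_k = 1] then only
    multiplies by ['X^l_k], so it merges with the preceding block, and what
    remains is the alternation of [G] and powers of ['X] over the blocks
    ([branch0_twist_poly]).  Such an alternation evaluated at 0 is a twisted
    multiple Bernoulli number ([TMBN_twist]): on the exponential of a linear
    form, [S] acts as multiplication by an exponential [exp T], so [G_x]
    multiplies it by [(1 - x exp T)^-1], and this is how the generating
    function is built. *)

(** * Translation operators on polynomials *)

Section ShiftOperators.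
Variable R : fieldType.
Implicit Types (U W f g : {poly R}) (x : R).

Definition shift x f : {poly R} := f \Po ('X + x%:P).

(** The polynomial [W] evaluated at the translation operator [shift 1]. *)
Definition shift_op W f : {poly R} :=
  \sum_(n < size W) W`_n *: shift n%:R f.

Lemma shift_opE n W f : (size W <= n)%N ->
  shift_op W f = \sum_(k < n) W`_k *: shift k%:R f.
Proof.
move=> Wn; rewrite /shift_op (big_ord_widen _ (fun k => W`_k *: shift k%:R f) Wn).
rewrite big_mkcond; apply: eq_bigr => k _ /=; case: ltnP => // Wk.
by rewrite nth_default ?scale0r.
Qed.

Lemma shift_opDl U W f : shift_op (U + W) f = shift_op U f + shift_op W f.
Proof.
have [m sU sW] : exists2 m, (size U <= m)%N & (size W <= m)%N.
  by exists (maxn (size U) (size W)); rewrite leq_max leqnn ?orbT.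
have sUW : (size (U + W)%R <= m)%N.
  by apply: leq_trans (size_polyD _ _) _; rewrite geq_max sU.
rewrite !(@shift_opE m) // -big_split /=.
by apply: eq_bigr => k _; rewrite coefD scalerDl.
Qed.

Lemma shift_opZl x W f : shift_op (x *: W) f = x *: shift_op W f.
Proof.
rewrite (@shift_opE (size W)) ?size_scale_leq // scaler_sumr.
by apply: eq_bigr => k _; rewrite coefZ scalerA.
Qed.

Lemma shift_opBl U W f : shift_op (U - W) f = shift_op U f - shift_op W f.
Proof. by rewrite -scaleN1r shift_opDl shift_opZl scaleN1r. Qed.

Lemma shift_op1 f : shift_op 1 f = f.
Proof.
by rewrite /shift_op size_poly1 big_ord1 coefC scale1r /shift addr0 comp_polyXr.
Qed.

Lemma shift_opXM W f : shift_op ('X * W) f = shift 1 (shift_op W f).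
Proof.
rewrite (@shift_opE (size W).+1); last first.
  by apply: leq_trans (size_polyMleq _ _) _; rewrite size_polyX.
rewrite big_ord_recl coefXM scale0r add0r /shift_op /shift raddf_sum /=.
apply: eq_bigr => k _; rewrite coefXM /= comp_polyZ -comp_polyA; congr (_ *: (_ \Po _)).
by rewrite comp_polyD comp_polyX comp_polyC -addrA -polyCD -nat1r.
Qed.

Lemma size_shift x f : size (shift x f) = size f.
Proof. by rewrite size_comp_poly2 // size_XaddC. Qed.

Lemma size_shift_op W f : (size (shift_op W f) <= size f)%N.
Proof.
apply: leq_trans (size_sum _ _ _) _; apply/bigmax_leqP => k _.
by apply: leq_trans (size_scale_leq _ _) _; rewrite size_shift.
Qed.

(** Translation keeps the leading coefficient. *)
Lemma size_shiftB f : (size (shift 1 f - f)%R <= (size f).-1)%N.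
Proof.
have sf := size_shift 1 f.
apply/leq_sizeP => j; rewrite leq_eqVlt => /predU1P[<-|ltj].
  rewrite coefB -{1}sf -!lead_coefE lead_coef_comp ?size_XaddC //.
  by rewrite lead_coefXaddC expr1n mulr1 subrr.
have lj : (size f <= j)%N by apply: leq_trans ltj; case: (size f).
by rewrite coefB !nth_default ?subrr // sf.
Qed.

Lemma shift_op_diffX d f : (size f <= d)%N -> shift_op (('X - 1) ^+ d) f = 0.
Proof.
move=> fd; apply/eqP; rewrite -size_poly_leq0.
suff: (size (shift_op (('X - 1) ^+ d)%R f) <= size f - d)%N.
  by move: fd; rewrite -subn_eq0 => /eqP ->.
elim: d {fd} => [|d IH]; first by rewrite expr0 shift_op1 subn0.
rewrite exprS mulrBl mul1r shift_opBl shift_opXM.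
by apply: leq_trans (size_shiftB _) _; rewrite subnS -!subn1 leq_sub2r.
Qed.

(** With [q = x / (1 - x)] one has [1 - x X = (1 - x) (1 - q (X - 1))]; this is
    the geometric series of its inverse, cut off at [(X - 1)^d].  One and the
    same polynomial serves to invert [1 - x S] on polynomials of size at most
    [d], where [(S - 1)^d] vanishes, and [1 - x f] on power series modulo degree
    [d] when [f] has constant term 1, since [(f - 1)^d] has order at least
    [d]. *)
Definition geom_poly d x : {poly R} :=
  (1 - x)^-1 *: \sum_(k < d) ((x / (1 - x)) *: ('X - 1)) ^+ k.

Lemma geom_polyE d x : x != 1 ->
  geom_poly d x - x *: ('X * geom_poly d x)
    = 1 - (x / (1 - x)) ^+ d *: ('X - 1) ^+ d.
Proof.
move=> x1; have nx : 1 - x != 0 by rewrite subr_eq0 eq_sym.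
set q := x / (1 - x); set D := 'X - 1 : {poly R}.
rewrite -exprZn -[RHS]opprB subrX1 -mulNr opprB /geom_poly -/q -/D.
set S := \sum_(k < d) _.
rewrite -scalerAr scalerA -/q mulrBl mul1r -scalerAl.
have -> : ('X * S = D * S + S) by rewrite /D mulrBl mul1r subrK.
rewrite scalerDr opprD addrA addrAC.
by congr (_ - _); rewrite -scalerBl /q -{1}[_^-1]mul1r -mulrBl divff ?scale1r.
Qed.

Lemma shift_op_geom d x f : x != 1 -> (size f <= d)%N ->
  shift_op (geom_poly d x) f - x *: shift 1 (shift_op (geom_poly d x) f) = f.
Proof.
move=> x1 fd; rewrite -shift_opXM -shift_opZl -shift_opBl geom_polyE //.
by rewrite shift_opBl shift_op1 shift_opZl shift_op_diffX // scaler0 subr0.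
Qed.

Lemma horner_shift x f a : (shift x f).[a] = f.[a + x].
Proof. by rewrite horner_comp !hornerE. Qed.

Lemma horner_shift_op W f a :
  (shift_op W f).[a] = \sum_(n < size W) W`_n * f.[a + n%:R].
Proof.
by rewrite horner_sum; apply: eq_bigr => n _; rewrite hornerZ horner_shift.
Qed.

(** The summand is [x^y (g - x S g)(b + y)], so the sum telescopes. *)
Lemma geom_sum d x f h b : x != 1 -> (size f <= d)%N ->
  let g := shift_op (geom_poly d x) f in
  \sum_(0 <= y < h) x ^+ y * f.[b + y%:R] = g.[b] - x ^+ h * g.[b + h%:R].
Proof.
move=> x1 fd g; elim: h => [|h IH]; first by rewrite big_geq // mul1r addr0 subrr.
rewrite big_nat_recr //= IH.
have fE : f = g - x *: shift 1 g by rewrite shift_op_geom.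
rewrite fE hornerD hornerN hornerZ horner_shift -natr1 addrA exprSr.
by rewrite mulrBr mulrA addrA subrK.
Qed.

(** In umbral terms, the value at [a] is the regularised sum over all
    [y_1, .., y_s >= 0] of the product of the
    [x_k^(y_k) (a + y_1 + .. + y_k)^(n_k)]. *)
Fixpoint twist_poly d (ns : seq nat) (xs : seq R) : {poly R} :=
  match ns, xs with
  | n :: ns', x :: xs' => shift_op (geom_poly d x) ('X^n * twist_poly d ns' xs')
  | _, _ => 1
  end.

End ShiftOperators.

(** * Exponentials of linear forms and twisted Bernoulli numbers *)

Section PowerSeries.
Variables (n : nat) (R : numFieldType).
Implicit Types (f g h : mfps n R) (m : 'X_{1..n}) (v w : 'I_n -> R).

Fact mfpsC_is_zmod_morphism : zmod_morphism (@mfpsC n R).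
Proof.
move=> a b; apply: mfpsP => m; rewrite mfcoefD mfcoefN /=.
by rewrite -mulrBr.
Qed.

Fact mfpsC_is_monoid_morphism : monoid_morphism (@mfpsC n R).
Proof.
by split=> // a b; apply: mfpsP => m; rewrite mfcoefCM /= mulrCA.
Qed.

HB.instance Definition _ :=
  GRing.isZmodMorphism.Build R (mfps n R) (@mfpsC n R) mfpsC_is_zmod_morphism.
HB.instance Definition _ :=
  GRing.isMonoidMorphism.Build R (mfps n R) (@mfpsC n R) mfpsC_is_monoid_morphism.

(** Orders of vanishing add up. *)
Lemma mfcoefM_lt a b f g m :
  (forall k, (mdeg k < a)%N -> mfcoef f k = 0) ->
  (forall k, (mdeg k < b)%N -> mfcoef g k = 0) ->
  (mdeg m < a + b)%N -> mfcoef (f * g) m = 0.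
Proof.
move=> f0 g0 mab; rewrite mfcoefM big1 // => k /eqP e.
have [/f0->|ak] := ltnP (mdeg k.1) a; first by rewrite mul0r.
rewrite g0 ?mulr0 // -(ltn_add2l a); apply: leq_ltn_trans mab.
by rewrite [X in (_ <= mdeg X)%N]e mdegD leq_add2r.
Qed.

Lemma mfcoef_exp f d m : mfcoef f 0%MM = 0 -> (mdeg m < d)%N ->
  mfcoef (mfps_exp f) m
    = mfcoef (\sum_(k < d) mfpsC n (k`!%:R)^-1 * f ^+ k) m.
Proof.
move=> f0 md; rewrite mfcoef_sum.
rewrite [LHS](big_ord_widen _ (fun k => k`!%:R^-1 * mfcoef (f ^+ k) m) md).
rewrite big_mkcond; apply: eq_bigr => k _; rewrite mfcoefCM; case: ifPn => //.
by rewrite -leqNgt => km; rewrite mfcoefX_lt ?mulr0.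
Qed.

Lemma mfps_exp0 : mfps_exp 0 = 1 :> mfps n R.
Proof.
apply: mfpsP => m /=; rewrite big_ord_recl big1 => [|i _].
  by rewrite invr1 mul1r addr0.
by rewrite expr0n /= mulr0 mulr0.
Qed.

(** In degree [< d] the series [exp f] is the value at 1 of
    [p f = \sum_(k < d) (f^k / k!) X^k].  By the binomial formula, the first [d]
    coefficients of [p f * p g] are those of [p (f + g)]; the others are made of
    terms [f^j g^k] with [j + k >= d], which have order at least [d]. *)
Lemma mfps_expD f g : mfcoef f 0%MM = 0 -> mfcoef g 0%MM = 0 ->
  mfps_exp (f + g) = mfps_exp f * mfps_exp g.
Proof.
move=> f0 g0; apply: mfpsP => m.
have fg0 : mfcoef (f + g) 0%MM = 0 by rewrite mfcoefD f0 g0 addr0.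
set d := (mdeg m).+1.
pose p h := \poly_(k < d) (mfpsC n (k`!%:R)^-1 * h ^+ k).
have pE h k : (mdeg k <= mdeg m)%N -> mfcoef h 0%MM = 0 ->
    mfcoef (mfps_exp h) k = mfcoef (p h).[1] k.
  move=> km h0; rewrite (@mfcoef_exp _ d) // /p horner_poly.
  by congr (mfcoef _ k); apply: eq_bigr => i _; rewrite expr1n mulr1.
rewrite (@mfcoefM_eq _ _ _ (p f).[1] _ (p g).[1]) => [|k km|k km]; last 2 first.
- exact: pE.
- exact: pE.
rewrite -hornerM (@horner_coef_wide _ (d + d)); last first.
  apply: leq_trans (size_polyMleq _ _) _.
  by apply: leq_trans (leq_pred _) _; rewrite leq_add ?size_poly.
rewrite big_split_ord mfcoefD mfcoef_sum [X in _ = _ + X]mfcoef_sum.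
rewrite [X in _ = _ + X]big1 => [|i _]; last first.
  rewrite expr1n mulr1 coefM mfcoef_sum big1 // => j _.
  rewrite !coef_poly; case: ltnP => _; last by rewrite mul0r mfcoef0.
  case: ltnP => _; last by rewrite mulr0 mfcoef0.
  rewrite mulrACA -rmorphM mfcoefCM (@mfcoefM_lt j (d + i - j)) ?mulr0 //.
  - by move=> k; apply: mfcoefX_lt.
  - by move=> k; apply: mfcoefX_lt.
  by rewrite subnKC ?leq_addr // -ltnS.
rewrite addr0 (@mfcoef_exp _ d) // mfcoef_sum; apply: eq_bigr => i _.
rewrite expr1n mulr1; congr (mfcoef _ m).
rewrite exprDn mulr_sumr coefMr; apply: eq_bigr => j _.
have ji : (j <= i)%N by rewrite -ltnS.
rewrite !coef_poly (leq_ltn_trans ji (ltn_ord i)).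
rewrite (leq_ltn_trans (leq_subr j i) (ltn_ord i)).
rewrite -[X in _ * X = _]mulr_natl [LHS]mulrA [RHS]mulrACA -!rmorphM.
rewrite -(rmorph_nat (@mfpsC n R)) -rmorphM.
congr (mfpsC _ _ * _).
have nz k : k`!%:R != 0 :> R by rewrite pnatr_eq0 -lt0n fact_gt0.
apply: (mulfI (nz i)); rewrite mulVKf // -(bin_fact ji) !natrM.
by rewrite -!mulrA mulVKf // mulfV // mulr1.
Qed.

Lemma mfcoefXM (i : 'I_n) g m :
  mfcoef (mfpsX R i * g) m = (0 < m i)%:R * mfcoef g (m - U_(i))%MM.
Proof.
rewrite mfcoefM; case: posnP => [mi|mi]; last first.
  have e : m = (U_(i) + (m - U_(i)))%MM.
    by rewrite addmC submK // lep1mP -lt0n.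
  have d1 : (mdeg U_(i)%MM < (mdeg m).+1)%N.
    by rewrite ltnS e mdegD leq_addr.
  have d2 : (mdeg (m - U_(i))%MM < (mdeg m).+1)%N.
    by rewrite ltnS [X in (_ <= mdeg X)%N]e mdegD leq_addl.
  rewrite (bigD1 (BMultinom d1, BMultinom d2)) /=; last by rewrite -e.
  rewrite eqxx mul1r big1 ?addr0 ?mul1r // => -[[k kd] [l ld]] /= /andP[/eqP ekl].
  case: (k =P U_(i)%MM) => [ek|]; last by rewrite mul0r.
  case/eqP; congr (_, _); apply: val_inj => //=.
  by rewrite ekl ek addmC addmK.
rewrite mul0r big1 // => k /eqP e /=; case: eqP => [ek|]; last by rewrite mul0r.
have := congr1 (fun q : 'X_{1..n} => q i) e.
by rewrite mi /= mnmDE ek mnm1E eqxx.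
Qed.

Definition linear_form v : mfps n R := \sum_(i < n) mfpsC n (v i) * mfpsX R i.

(** The coefficient of index [m] of [exp (\sum_i v_i t_i)]. *)
Definition exp_coef v m : R := \prod_(i < n) (v i ^+ m i / (m i)`!%:R).

Lemma linear_form0 v : mfcoef (linear_form v) 0%MM = 0.
Proof.
rewrite mfcoef_sum big1 // => i _.
by rewrite mfcoef0M /= eq_sym mnm1_eq0 mulr0.
Qed.

Lemma exp_coefB v m i : (0 < m i)%N ->
  v i * exp_coef v (m - U_(i))%MM = (m i)%:R * exp_coef v m.
Proof.
move=> mi; rewrite /exp_coef (bigD1 i) //= [in RHS](bigD1 i) //= !mulrA.
congr (_ * _); last first.
  apply: eq_bigr => j ji; rewrite mnmBE mnm1E.
  by rewrite eq_sym (negbTE ji) subn0.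
rewrite mnmBE mnm1E eqxx; case: (m i) mi => // k _; rewrite subn1 /= factS exprS.
by rewrite natrM invfM [RHS]mulrACA divff ?mul1r // pnatr_eq0.
Qed.

(** The multinomial formula, by induction on [k]: by [exp_coefB], removing one
    [t_i] from the monomial [m] contributes the factor [m i], and these add up to
    the degree of [m]. *)
Lemma mfcoef_linear_formX v k m :
  mfcoef (linear_form v ^+ k) m = (mdeg m == k)%:R * k`!%:R * exp_coef v m.
Proof.
elim: k m => [|k IH] m.
  rewrite expr0 mfcoef1 mdeg_eq0; case: eqP => [->|]; last by rewrite !mul0r.
  by rewrite !mul1r /exp_coef big1 // => i _; rewrite mnm0E expr0 divr1.
rewrite exprS mulr_suml mfcoef_sum.
under eq_bigr => i _ do rewrite -mulrA mfcoefCM mfcoefXM IH.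
transitivity (\sum_(i < n) (mdeg m == k.+1)%:R * k`!%:R * exp_coef v m * (m i)%:R).
  apply: eq_bigr => i _; case: posnP => [->|mi]; first by rewrite mul0r !mulr0.
  have -> : (mdeg (m - U_(i))%MM == k) = (mdeg m == k.+1).
    have {2}-> : m = (m - U_(i) + U_(i))%MM by rewrite submK // lep1mP -lt0n.
    by rewrite mdegD mdeg1 addn1.
  by rewrite mul1r mulrCA exp_coefB // [_ * exp_coef v m]mulrC mulrA.
rewrite -mulr_sumr -natr_sum -mdegE factS mulnC natrM.
case: eqP => [->|_]; last by rewrite !mul0r.
by rewrite !mul1r mulrAC.
Qed.

Definition exp_form v := mfps_exp (linear_form v).

Lemma mfcoef_exp_form v m : mfcoef (exp_form v) m = exp_coef v m.
Proof.
rewrite /= big_ord_recr /= big1 => [|k _].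
  rewrite add0r mfcoef_linear_formX eqxx mul1r mulrA mulVf ?mul1r //.
  by rewrite pnatr_eq0 -lt0n fact_gt0.
by rewrite mfcoef_linear_formX gtn_eqF // !mul0r mulr0.
Qed.

Lemma exp_formD v w : exp_form (fun i => v i + w i) = exp_form v * exp_form w.
Proof.
rewrite /exp_form -mfps_expD ?linear_form0 //; congr mfps_exp; rewrite -big_split.
by apply: eq_bigr => i _; rewrite rmorphD mulrDl.
Qed.

Lemma exp_formX v k : exp_form v ^+ k = exp_form (fun i => k%:R * v i).
Proof.
elim: k => [|k IH].
  rewrite expr0 /exp_form (_ : linear_form _ = 0) ?mfps_exp0 //.
  rewrite /linear_form big1 // => i _.
  by rewrite mul0r rmorph0 mul0r.
rewrite exprSr IH -exp_formD; congr exp_form; apply: funext => i.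
by rewrite -natr1 mulrDl mul1r.
Qed.

(** The polynomial [geom_poly d x] evaluated at [f] differs from
    [(1 - x f)^-1] by a multiple of [(f - 1)^d], which has order at least [d]. *)
Lemma mfcoef_geom d x f g m : x != 1 -> mfcoef f 0%MM = 1 -> (mdeg m < d)%N ->
  mfcoef ((1 - mfpsC n x * f)^-1 * g) m
    = \sum_(k < size (geom_poly d x)) (geom_poly d x)`_k * mfcoef (f ^+ k * g) m.
Proof.
move=> x1 f1 md; move: (geom_poly d x) (geom_polyE d x1) => W WE.
pose ev (p : {poly R}) := (map_poly (@mfpsC n R) p).[f].
have uf : 1 - mfpsC n x * f \is a GRing.unit.
  rewrite -[_ \is a _]/(mfps_unit _) /mfps_unit mfcoefD mfcoefN mfcoef0M mfcoef1.
  by rewrite f1 /= eqxx mulr1 mul1r unitfE subr_eq0 eq_sym.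
have evW : (1 - mfpsC n x * f) * ev W
    = 1 - mfpsC n ((x / (1 - x)) ^+ d) * (f - 1) ^+ d.
  have := congr1 ev WE; rewrite /ev.
  rewrite !rmorphB /= !map_polyZ rmorphM /= [map_poly _ (_ ^+ d)]rmorphXn /=.
  rewrite rmorphB /= map_polyX !rmorph1.
  rewrite !(hornerD, hornerN, hornerZ, hornerM, hornerX, hornerC, horner_exp) => <-.
  by rewrite mulrBl mul1r mulrA.
move: (1 - _) uf evW => u uf; set c := mfpsC n _ => evW.
have -> : u^-1 * g = ev W * g + (f - 1) ^+ d * (c * u^-1 * g).
  rewrite mulrA -mulrDl; congr (_ * _); apply: (mulrI uf).
  by rewrite divrr // mulrDr evW mulrCA [u * _]mulrCA divrr // mulr1 [_ * c]mulrC subrK.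
rewrite mfcoefD [X in _ + X](@mfcoefM_lt d 0) ?addn0 // => [|k kd]; last first.
  by rewrite mfcoefX_lt // mfcoefD mfcoefN f1 mfcoef1 eqxx subrr.
rewrite addr0 /ev horner_poly mulr_suml mfcoef_sum; apply: eq_bigr => k _.
by rewrite -mulrA mfcoefCM.
Qed.

End PowerSeries.

Lemma TMBN_genE (xs : seq algC) : TMBN_gen xs =
  \prod_(j < size xs)
    (1 - mfpsC _ xs`_j * exp_form (fun k : 'I_(size xs) => (j <= k)%N%:R))^-1.
Proof.
apply: eq_bigr => j _; congr (1 - _ * mfps_exp _)^-1; rewrite big_mkcond.
apply: eq_bigr => k _; case: ifP => _; first by rewrite rmorph1 mul1r.
by rewrite rmorph0 mul0r.
Qed.

(** The factors are treated from the last one to the first.  Multiplying the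
    exponential of a form [v] which is constantly [a] from index [j] on by the
    [z]-th power of [exp (t_j + t_(j+1) + ..)] replaces [a] by [a + z], so that
    by [mfcoef_geom] the factor of index [j] acts on the coefficients as the
    shift operator that defines [twist_poly]. *)
Lemma TMBN_twist d (ns : seq nat) (xs : seq algC) :
  size ns = size xs -> (forall x, x \in xs -> x != 1) -> (sumn ns < d)%N ->
  TMBN ns xs = (twist_poly d ns xs).[0].
Proof.
move=> sz x1 nd; rewrite /TMBN TMBN_genE; set s := size xs.
pose m : 'X_{1..s} := [multinom nth 0%N ns j | j < s].
have mi (i : 'I_s) : m i = nth 0%N ns i by rewrite mnmE.
have md : (mdeg m < d)%N.
  apply: leq_ltn_trans nd; rewrite mdegE.
  rewrite sumnE (big_nth 0%N) sz big_mkord.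
  by apply: eq_leq; apply: eq_bigr => i _; rewrite mi.
pose y (j : nat) := exp_form (fun k : 'I_s => (j <= k)%N%:R : algC).
have y1 j : mfcoef (y j) 0%MM = 1.
  by rewrite mfcoef_exp_form /exp_coef big1 // => i _; rewrite mnm0E expr0 divr1.
pose M := (\prod_(i < s) (m i)`!)%:R : algC.
have Mcoef v : M * exp_coef v m = \prod_(i < s) v i ^+ m i.
  rewrite /M natr_prod -big_split /=; apply: eq_bigr => i _.
  by rewrite mulrCA divff ?mulr1 // pnatr_eq0 -lt0n fact_gt0.
(* The induction is on the number k of factors already multiplied, which are
   those of index at least s - k. *)
have key k (v : 'I_s -> algC) a : (k <= s)%N ->
    (forall i : 'I_s, (s - k <= i)%N -> v i = a) ->
  M * mfcoef ((\prod_(i < s | (s - k <= i)%N) (1 - mfpsC _ xs`_i * y i)^-1)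
              * exp_form v) m
  = (\prod_(i < s | (i < s - k)%N) v i ^+ m i)
    * (twist_poly d (drop (s - k) ns) (drop (s - k) xs)).[a].
  elim: k v a => [|k IH] v a ks va.
    rewrite subn0 big_pred0 => [|i]; last by rewrite leqNgt ltn_ord.
    rewrite mul1r mfcoef_exp_form Mcoef drop_oversize ?sz // /= hornerC mulr1.
    by apply: eq_bigl => i; rewrite ltn_ord.
  set j := (s - k.+1)%N in va *.
  have sk : (s - k = j.+1)%N by rewrite /j subnSK.
  rewrite {}sk in IH.
  have js : (j < s)%N by rewrite /j -subSn // subSS leq_subr.
  pose jo := Ordinal js.
  rewrite (@drop_nth _ 0%N j ns) ?sz // (@drop_nth _ 0 j xs) //.
  rewrite [twist_poly _ _ _]/= horner_shift_op [RHS]mulr_sumr.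
  have -> : \prod_(i < s | (j <= i)%N) (1 - mfpsC s xs`_i * y i)^-1
      = (1 - mfpsC s xs`_j * y j)^-1
        * \prod_(i < s | (j <= i)%N && (i != jo)) (1 - mfpsC s xs`_i * y i)^-1.
    by rewrite (bigD1 jo).
  rewrite -mulrA (@mfcoef_geom _ _ d) //; last first.
    by apply: x1; apply: mem_nth.
  rewrite [LHS]mulr_sumr; apply: eq_bigr => z _.
  rewrite mulrCA [RHS]mulrCA; congr (_ * _).
  pose v' (i : 'I_s) : algC := v i + z%:R * (j <= i)%N%:R.
  have va' (i : 'I_s) : (j < i)%N -> v' i = a + z%:R.
    by move=> ji; rewrite /v' va ?(ltnW ji) // mulr1.
  have -> : y j ^+ z * ((\prod_(i < s | (j <= i)%N && (i != jo))
       (1 - mfpsC s xs`_i * y i)^-1) * exp_form v)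
     = (\prod_(i < s | (j < i)%N) (1 - mfpsC s xs`_i * y i)^-1) * exp_form v'.
    rewrite mulrCA [y j ^+ z * _]mulrC exp_formX -exp_formD; congr (_ * _).
    by apply: eq_bigl => i; rewrite ltn_neqAle andbC eq_sym.
  rewrite (IH v' (a + z%:R)) ?(ltnW ks) // (bigD1 jo) // hornerM hornerXn [RHS]mulrA.
  congr (_ * _); rewrite [LHS]mulrC; congr (_ * _); last first.
    by rewrite mi /v' va ?leqnn // mulr1.
  apply: eq_big => i; first by rewrite ltnS ltn_neqAle andbC.
  case/andP; rewrite ltnS => ij' ne.
  have {ij' ne} ij : (i < j)%N by rewrite ltn_neqAle ne.
  by rewrite /v' leqNgt ij mulr0 addr0.
have := key s (fun _ => 0) 0 (leqnn _) (fun _ _ => erefl).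
rewrite subnn !drop0 [X in _ = X * _]big_pred0 => [|i]; last by [].
rewrite [RHS]mul1r => <-.
rewrite (_ : exp_form _ = 1); last first.
  rewrite -[RHS](expr0 (exp_form (fun=> 0))) exp_formX; congr exp_form.
  by apply: funext => i; rewrite mul0r.
rewrite mulr1 /M; under [in RHS]eq_bigr => i _ do rewrite mi.
by congr (_ * mfcoef _ _); apply: eq_bigl => i.
Qed.

(** * Polynomial families and branches *)

Section PolynomialFamilies.
Variables (R : fieldType) (K : divringClosed R).
Implicit Types (F G : nat -> {poly R}).

(** The families [h |-> F h] of polynomials in a variable [a] that are given by
    one polynomial in [(h, a)] over [K] of total degree at most [d].  Bounding
    the total degree, rather than the degree in [h], is what makes the bound
    stable under translations of [a] by multiples of [h]. *)
Inductive polyfam : nat -> (nat -> {poly R}) -> Prop :=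
| PolyfamC d c : c \in K -> polyfam d (fun=> c%:P)
| PolyfamX : polyfam 1 (fun=> 'X)
| PolyfamPar : polyfam 1 (fun h => h%:R%:P)
| PolyfamD d F G :
    polyfam d F -> polyfam d G -> polyfam d (fun h => F h + G h)
| PolyfamM d e F G :
    polyfam d F -> polyfam e G -> polyfam (d + e) (fun h => F h * G h).

Lemma polyfam_shift k m d F : polyfam d F ->
  polyfam d (fun h => shift (k + m * h)%:R (F h)).
Proof.
have natK n : n%:R \in K by rewrite rpred_nat.
elim=> {d F} [d c cK|||d F G _ IF _ IG|d e F G _ IF _ IG].
- by rewrite /shift; under eq_fun do rewrite comp_polyC; apply: PolyfamC.
- rewrite /shift; under eq_fun do
    rewrite comp_polyX natrD natrM !polyCD polyCM addrA.
  apply: PolyfamD.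
    by apply: PolyfamD; [exact: PolyfamX | exact: PolyfamC].
  by apply: (@PolyfamM 0 1); [exact: PolyfamC | exact: PolyfamPar].
- by rewrite /shift; under eq_fun do rewrite comp_polyC; exact: PolyfamPar.
- by rewrite /shift; under eq_fun do rewrite comp_polyD; exact: PolyfamD.
by rewrite /shift; under eq_fun do rewrite comp_polyM; exact: PolyfamM.
Qed.

Lemma polyfam_sum d n (F : 'I_n -> nat -> {poly R}) :
  (forall i, polyfam d (F i)) -> polyfam d (fun h => \sum_(i < n) F i h).
Proof.
elim: n F => [|n IH] F FF.
  under eq_fun do rewrite big_ord0 -polyC0.
  by apply: PolyfamC; rewrite rpred0.
under eq_fun do rewrite big_ord_recr.
by apply: PolyfamD => //; apply: IH.
Qed.

Lemma polyfam_shift_op W d F : W \is a polyOver K ->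
  polyfam d F -> polyfam d (fun h => shift_op W (F h)).
Proof.
move=> /polyOverP WK FF; apply: polyfam_sum => i.
under eq_fun do rewrite -mul_polyC.
apply: (@PolyfamM 0 d); first exact: PolyfamC.
by have := polyfam_shift i 0 FF; under eq_fun do rewrite mul0n addn0.
Qed.

Lemma polyfam_Xn n : polyfam n (fun=> 'X^n).
Proof.
elim: n => [|n IH]; first by apply: PolyfamC; rewrite rpred1.
by under eq_fun do rewrite exprS; apply: (@PolyfamM 1 n) => //; apply: PolyfamX.
Qed.

Lemma polyfam_value0 d F : polyfam d F ->
  exists w : {poly R}, [/\ w \is a polyOver K, (size w <= d.+1)%N
    & forall h, (F h).[0] = w.[h%:R]].
Proof.
elim=> {d F} [d c cK|||d F G _ IF _ IG|d e F G _ IF _ IG].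
- exists c%:P; split=> [||h]; rewrite ?polyOverC ?hornerC //.
  by apply: leq_trans (size_polyC_leq1 _) _.
- exists 0; split=> [||h]; rewrite ?rpred0 ?size_poly0 //.
  by rewrite hornerX horner0.
- exists 'X; split=> [||h]; rewrite ?polyOverX ?size_polyX //.
  by rewrite hornerX hornerC.
- case: IF => w [wK sw wE]; case: IG => z [zK sz zE].
  exists (w + z); split=> [||h]; rewrite ?rpredD ?hornerD ?wE ?zE //.
  by apply: leq_trans (size_polyD _ _) _; rewrite geq_max sw.
case: IF => w [wK sw wE]; case: IG => z [zK sz zE].
exists (w * z); split=> [||h]; rewrite ?rpredM ?hornerM ?wE ?zE //.
apply: leq_trans (size_polyMleq _ _) _.
rewrite -subn1 leq_subLR; apply: leq_trans (leq_add sw sz) _.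
by rewrite addSn addnS.
Qed.

Lemma polyOver_geom_poly d x : x \in K -> geom_poly d x \is a polyOver K.
Proof.
move=> xK; have yK : (1 - x)^-1 \in K by rewrite rpredV rpredB ?rpred1.
rewrite /geom_poly polyOverZ ?rpred_sum // => i _.
by rewrite rpredX // polyOverZ ?rpredM // rpredB ?polyOverX ?rpred1.
Qed.

(** The contribution of the choices [(es, js)] to the iterated sum, as a
    polynomial in the starting point of the first gap: [e = false] stands for a
    boundary term of the telescoping sum, at the lower end if [j = false] and at
    the upper end if [j = true]; [e = true] stands for the excluded point
    [k * h]. *)
Fixpoint branch d (ks ls : seq nat) (xs : seq R) (es js : seq bool) (h : nat)
    {struct ks} : {poly R} :=
  match ks, ls, xs, es, js with
  | k :: ks', l :: ls', x :: xs', e :: es', j :: js' =>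
      let f := 'X^l * branch d ks' ls' xs' es' js' h in
      shift ((k + j) * h)%:R (if e then f else shift_op (geom_poly d x) f)
  | _, _, _, _, _ => 1
  end.

Lemma polyfam_branch d ks ls xs es js : {subset xs <= K} ->
  polyfam (sumn ls) (branch d ks ls xs es js).
Proof.
have fam1 n : polyfam n (fun=> 1) by apply: PolyfamC; rewrite rpred1.
elim: ks ls xs es js => [|k ks IH] [|l ls] [|x xs] [|e es] [|j js] //= xK.
have xsK : {subset xs <= K} by move=> y yxs; apply: xK; rewrite inE yxs orbT.
have FF : polyfam (l + sumn ls) (fun h => 'X^l * branch d ks ls xs es js h).
  by apply: PolyfamM; [exact: polyfam_Xn | exact: IH].
have sh n F : polyfam n F -> polyfam n (fun h => shift ((k + j) * h)%:R (F h)).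
  by move/(polyfam_shift 0 (k + j)); under eq_fun do rewrite add0n.
apply: sh; case: e => //; apply: polyfam_shift_op => //.
by apply: polyOver_geom_poly; apply: xK; rewrite inE eqxx.
Qed.

End PolynomialFamilies.

(** * Harmonic sums as iterated sums over gaps *)

Lemma big_tuple_cons (V : nmodType) (T : finType) n (P : pred (seq T))
    (F : seq T -> V) :
  \sum_(t : n.+1.-tuple T | P t) F t
    = \sum_(x : T) \sum_(t : n.-tuple T | P (x :: t)) F (x :: t).
Proof.
rewrite pair_big_dep /=.
rewrite (reindex (fun p : T * n.-tuple T => [tuple of p.1 :: p.2])) //=.
exists (fun t : n.+1.-tuple T => (thead t, [tuple of behead t])) => [[x t] _|t _] /=.
  by congr (_, _); apply: val_inj.
by rewrite [RHS]tuple_eta; apply: val_inj.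
Qed.

Lemma big_tuple0 (V : nmodType) (T : finType) (P : pred (seq T)) (F : seq T -> V) :
  P [::] -> \sum_(t : 0.-tuple T | P t) F t = F [::].
Proof.
move=> P0; rewrite (big_pred1 [tuple]) // => t.
by rewrite (tuple0 t) /= P0; apply/esym/eqP.
Qed.

(** [a] is the entry preceding the ones that are summed over. *)
Fixpoint gap_sum (ks ls : seq nat) (xs : seq algC) (h a : nat) : algC :=
  match ks, ls, xs with
  | k :: ks', l :: ls', x :: xs' =>
      \sum_(1 <= y < h) x ^+ (k * h + y) *
         ((a + k * h + y)%:R ^+ l * gap_sum ks' ls' xs' h (a + k * h + y))
  | _, _, _ => 1
  end.

(** The part of [harm_dom] that concerns the entries [u] following the entry
    [a]. *)
Definition gap_dom (ks : seq nat) (h a : nat) (u : seq nat) : bool :=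
  all (fun i => (nth 0%N (a :: u) i + nth 0%N ks i * h < nth 0%N u i)%N
             && (nth 0%N u i < nth 0%N (a :: u) i + (nth 0%N ks i).+1 * h)%N)
      (iota 0 (size u)).

Lemma harm_dom_cons ks h a u :
  harm_dom ks h (a :: u) = (a < h)%N && gap_dom ks h a u.
Proof. by []. Qed.

Lemma gap_dom_cons k ks h a b u : gap_dom (k :: ks) h a (b :: u) =
  (a + k * h < b < a + k.+1 * h)%N && gap_dom ks h b u.
Proof.
rewrite /gap_dom /= -[1%N]addn0 iotaDl all_map; congr (_ && _).
Qed.

(** A weight of the form [(e / e')^a] couples two consecutive entries; giving its
    factor [e^a] to the entries that follow [a] makes the weight of each entry
    depend on its gap only. *)
Definition gap_term (ls : seq nat) (es : seq algC) (a : nat) (u : seq nat) : algC :=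
  if u is [::] then 1 else es`_0 ^+ a * harm_term ls es u.

Lemma harm_term_cons l ls e es a u :
  harm_term (l :: ls) (e :: es) (a :: u)
    = e^-1 ^+ a * (a%:R ^+ l * gap_term ls es a u).
Proof.
case: u => [|b u].
  by rewrite /harm_term /= big_ord0 big_ord1 /= mul1r div1r mulr1.
rewrite /gap_term.
have [T TE] : {T | T = harm_term ls es (b :: u)} by eexists.
rewrite -TE [X in _ = _ * X]mulrCA [RHS]mulrCA [RHS]mulrA -exprMn TE /harm_term.
rewrite big_ord_recl [X in _ * X = _]big_ord_recl /=.
rewrite -!mulrA; congr (_ * _); rewrite [RHS]mulrCA; congr (_ * _).
by rewrite [RHS]mulrCA.
Qed.

Lemma gap_term_cons l ls e es a b u : (a <= b)%N -> e != 0 ->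
  gap_term (l :: ls) (e :: es) a (b :: u)
    = e^-1 ^+ (b - a) * (b%:R ^+ l * gap_term ls es b u).
Proof.
move=> ab e0; rewrite [LHS]/gap_term harm_term_cons mulrA; congr (_ * _).
by rewrite -{1}(subnK ab) exprD mulrCA -exprMn divff // expr1n mulr1.
Qed.

(** The condition on [N] makes the range ['I_N] large enough for all the tuples
    satisfying the inequalities of [gap_dom]. *)
Lemma sum_gap_term n ks ls es N h a :
  size ks = n -> size ls = n -> size es = n -> {in es, forall e, e != 0} ->
  (a + h * (n + sumn ks) <= N)%N ->
  \sum_(u : n.-tuple 'I_N | gap_dom ks h a (map val u))
     gap_term ls es a (map val u)
    = gap_sum ks ls (map GRing.inv es) h a.
Proof.
elim: n ks ls es a => [|n IH] [|k ks] [|l ls] [|e es] //= a.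
  move=> _ _ _ _ _; rewrite (@big_tuple0 _ _ (fun u => gap_dom [::] h a (map val u))
    (fun u => gap_term [::] [::] a (map val u))) //.
move=> [szk] [szl] [sze] es0 aN.
rewrite (@big_tuple_cons _ _ n (fun u => gap_dom (k :: ks) h a (map val u))
    (fun u => gap_term (l :: ls) (e :: es) a (map val u))).
pose G b := e^-1 ^+ (b - a) * (b%:R ^+ l * gap_sum ks ls (map GRing.inv es) h b).
transitivity (\sum_(b < N | (a + k * h < b < a + k.+1 * h)%N) G b).
  rewrite [RHS]big_mkcond; apply: eq_bigr => b _.
  under eq_bigl => u do rewrite map_cons gap_dom_cons.
  case: ifP => [/andP[ab ba]|_]; last by rewrite big_pred0.
  have leab : (a <= b)%N by rewrite (leq_trans _ (ltnW ab)) ?leq_addr.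
  rewrite /G -IH //; last 2 first.
  - by move=> y yes; apply: es0; rewrite inE yes orbT.
  - apply: leq_trans aN; apply: leq_trans (leq_add (ltnW ba) (leqnn _)) _.
    rewrite -addnA leq_add2l mulnC -mulnDr leq_mul2l; apply/orP; right.
    by rewrite !addSn addnCA.
  rewrite !mulr_sumr; apply: eq_bigr => u _.
  by rewrite map_cons gap_term_cons // es0 ?inE ?eqxx.
have aN' : (a + k.+1 * h <= N)%N.
  apply: leq_trans aN; rewrite leq_add2l mulnC leq_mul2l; apply/orP; right.
  by rewrite addSn ltnS addnCA leq_addr.
transitivity (\sum_((a + k * h).+1 <= b < a + k.+1 * h) G b).
  rewrite (big_nat_widen _ _ _ _ _ aN') big_geq_mkord.
  by apply: eq_bigl => b; rewrite /= andbC.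
rewrite -add1n (big_addn _ _ (a + k * h)) mulSn addnA [(a + h)%N]addnC -addnA addnK.
apply: eq_big_nat => y /andP[y1 yh]; rewrite /G addnC.
by rewrite -addnA addKn addnA.
Qed.

Lemma harm_sumE n l0 e0 (ls : n.-tuple nat) (es : n.-tuple algC)
    (ks : n.-tuple nat) h : {in es, forall e, e != 0} ->
  harm_sum [tuple of l0 :: ls] [tuple of e0 :: es] (ks : (n.+1).-1.-tuple nat) h
  = \sum_(0 <= y < h) e0^-1 ^+ y
      * (y%:R ^+ l0 * gap_sum ks ls (map GRing.inv es) h y).
Proof.
move=> es0; rewrite /harm_sum; set N := harm_bound _ _ _.
rewrite (@big_tuple_cons _ _ n (fun u => harm_dom ks h (map val u))
    (fun u => harm_term (l0 :: ls) (e0 :: es) (map val u))).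
have hN : (h <= N)%N by rewrite /N /harm_bound addSn mulnS leq_addr.
rewrite (big_nat_widen _ _ _ _ _ hN) big_mkord [RHS]big_mkcond.
apply: eq_bigr => b _.
under eq_bigl => u do rewrite map_cons harm_dom_cons.
rewrite andTb; case: ifP => bh; last by rewrite big_pred0.
rewrite -(@sum_gap_term n _ _ _ N) ?size_tuple //; last first.
  apply: (@leq_trans (h + h * (n + sumn ks))); last by rewrite -mulnS.
  by rewrite leq_add2r ltnW.
rewrite !mulr_sumr; apply: eq_bigr => u _.
by rewrite map_cons harm_term_cons.
Qed.

(** * Expansion into branches *)

Definition compat (es js : seq bool) : bool := all2 (fun e j => ~~ (e && j)) es js.

Lemma compatE n (es js : n.-tuple bool) :
  [forall k : 'I_n, (tnth js k <= 1 - tnth es k)%N] = compat es js.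
Proof.
rewrite /compat all2E !size_tuple eqxx /=.
apply/forallP/(all_nthP (false, false)) => [H i|H i].
  rewrite size_zip !size_tuple minnn => ir; have := H (Ordinal ir).
  rewrite nth_zip ?size_tuple //= !(tnth_nth false) /=.
  by case: (nth _ es i); case: (nth _ js i).
have := H i; rewrite size_zip !size_tuple minnn ltn_ord => /(_ isT).
rewrite nth_zip ?size_tuple //= !(tnth_nth false) /=.
by case: (nth _ es i); case: (nth _ js i).
Qed.

Definition choice_sum n (F : seq bool -> seq bool -> algC) : algC :=
  \sum_(es : n.-tuple bool) \sum_(js : n.-tuple bool | compat es js) F es js.

Lemma eq_choice_sum n F G : F =2 G -> choice_sum n F = choice_sum n G.
Proof. by move=> FG; apply: eq_bigr => es _; apply: eq_bigr => js _. Qed.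

Lemma choice_sum0 F : choice_sum 0 F = F [::] [::].
Proof.
rewrite /choice_sum (@big_tuple0 _ _ xpredT
  (fun es => \sum_(js : 0.-tuple bool | compat es js) F es js)) //.
by rewrite (@big_tuple0 _ _ (compat [::]) (F [::])).
Qed.

Lemma choice_sumS n F : choice_sum n.+1 F =
  choice_sum n (fun es js => F (false :: es) (false :: js)
    + F (false :: es) (true :: js) + F (true :: es) (false :: js)).
Proof.
rewrite /choice_sum (@big_tuple_cons _ _ n xpredT
  (fun es => \sum_(js : n.+1.-tuple bool | compat es js) F es js)).
rewrite big_bool [LHS]addrC -big_split; apply: eq_bigr => es _.
rewrite (@big_tuple_cons _ _ n (compat (false :: es)) (F (false :: es))).
rewrite (@big_tuple_cons _ _ n (compat (true :: es)) (F (true :: es))) !big_bool /=.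
rewrite [X in _ + (X + _)]big_pred0 // add0r !big_split /=.
by congr (_ + _); rewrite addrC.
Qed.

Lemma choice_sumM n F c : c * choice_sum n F = choice_sum n (fun es js => c * F es js).
Proof.
by rewrite /choice_sum mulr_sumr; apply: eq_bigr => es _; rewrite mulr_sumr.
Qed.

Lemma choice_sum_nat n m1 m2 (F : nat -> seq bool -> seq bool -> algC) :
  \sum_(m1 <= y < m2) choice_sum n (F y)
   = choice_sum n (fun es js => \sum_(m1 <= y < m2) F y es js).
Proof.
rewrite /choice_sum exchange_big; apply: eq_bigr => es _.
by rewrite exchange_big.
Qed.

Fixpoint sign_exponent (es js : seq bool) : nat :=
  match es, js with
  | e :: es', j :: js' => (e + j + sign_exponent es' js')%N
  | _, _ => 0%N
  end.

Fixpoint branch_char (ks : seq nat) (xs : seq algC) (js : seq bool) : algC :=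
  match ks, xs, js with
  | k :: ks', x :: xs', j :: js' => x ^+ (k + j) * branch_char ks' xs' js'
  | _, _, _ => 1
  end.

Definition branch_term d ks ls xs h (x : algC) es js : algC :=
  (-1) ^+ sign_exponent es js * branch_char ks xs js ^+ h
    * (branch d ks ls xs es js h).[x].

Lemma size_branch d ks ls (xs : seq algC) es js h :
  (size (branch d ks ls xs es js h) <= (sumn ls).+1)%N.
Proof.
elim: ks ls xs es js => [|k ks IH] [|l ls] [|x xs] [|e es] [|j js] /=;
  rewrite ?size_poly1 //.
rewrite size_shift.
have sf : (size ('X^l * branch d ks ls xs es js h)%R <= (l + sumn ls).+1)%N.
  apply: leq_trans (size_polyMleq _ _) _.
  by rewrite size_polyXn -(addnS l (sumn ls)) leq_add2l.
by case: e => //; apply: leq_trans (size_shift_op _ _) _.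
Qed.

(** The telescoping sum over [0 <= y < h], from which the term [y = 0], excluded
    by the strict inequality, is subtracted. *)
Lemma gap_geom_sum d x (f : {poly algC}) k h a : (0 < h)%N -> x != 1 ->
  (size f <= d)%N ->
  let g := shift_op (geom_poly d x) f in
  \sum_(1 <= y < h) x ^+ (k * h + y) * f.[(a + k * h + y)%:R]
  = (x ^+ k) ^+ h * (shift (k * h)%:R g).[a%:R]
    - (x ^+ k.+1) ^+ h * (shift (k.+1 * h)%:R g).[a%:R]
    - (x ^+ k) ^+ h * (shift (k * h)%:R f).[a%:R].
Proof.
move=> h0 x1 fd g.
rewrite !horner_shift -!natrD -!exprM.
have -> : \sum_(1 <= y < h) x ^+ (k * h + y) * f.[(a + k * h + y)%:R]
  = \sum_(0 <= y < h) x ^+ (k * h) * (x ^+ y * f.[(a + k * h)%:R + y%:R])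
      - x ^+ (k * h) * f.[(a + k * h)%:R].
  rewrite [in RHS]big_ltn // mul1r addr0 [X in X - _]addrC addrK.
  by apply: eq_bigr => y _; rewrite exprD mulrA natrD.
rewrite -mulr_sumr (geom_sum _ _ x1 fd) -/g mulrBr mulrA -exprD -natrD.
by rewrite -addnA -[(k * h + h)%N]addnC -mulSn.
Qed.

(** For fixed choices in the later gaps, the summand is a polynomial evaluated at
    the current entry, so [gap_geom_sum] applies; its three terms are the three
    compatible choices in the first gap. *)
Lemma gap_sum_branch d n ks ls xs h a :
  size ks = n -> size ls = n -> size xs = n ->
  {in xs, forall x, x != 1} -> (sumn ls < d)%N -> (0 < h)%N ->
  gap_sum ks ls xs h a = choice_sum n (branch_term d ks ls xs h a%:R).
Proof.
elim: n ks ls xs a => [|n IH] [|k ks] [|l ls] [|x xs] //= a.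
  move=> _ _ _ _ _ _; rewrite choice_sum0 /branch_term /= expr0 mul1r expr1n.
  by rewrite mul1r hornerC.
move=> [szk] [szl] [szx] xs1 ld h0.
have xs1' : {in xs, forall x, x != 1}.
  by move=> y yxs; apply: xs1; rewrite inE yxs orbT.
have ld' : (sumn ls < d)%N by apply: leq_ltn_trans ld; rewrite leq_addl.
have x1 : x != 1 by apply: xs1; rewrite inE eqxx.
under eq_bigr => y _ do rewrite (IH ks ls xs _) // !choice_sumM.
rewrite choice_sum_nat choice_sumS; apply: eq_choice_sum => es js.
pose f := 'X^l * branch d ks ls xs es js h.
have sf : (size f <= d)%N.
  apply: leq_trans (size_polyMleq _ _) _; rewrite size_polyXn addSn /=.
  by apply: leq_trans ld; rewrite -(addnS l (sumn ls)) leq_add2l size_branch.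
pose c := (-1) ^+ sign_exponent es js * branch_char ks xs js ^+ h.
transitivity (c * \sum_(1 <= y < h) x ^+ (k * h + y) * f.[(a + k * h + y)%:R]).
  rewrite mulr_sumr; apply: eq_bigr => y _.
  rewrite /branch_term -/c /f hornerM hornerXn [RHS]mulrCA; congr (_ * _).
  by rewrite [RHS]mulrCA.
rewrite (gap_geom_sum _ _ h0 x1 sf) /branch_term /= -/f.
rewrite !addn0 !addn1 !add0n !add1n !exprS !exprMn /c.
ring.
Qed.

Lemma big_root_choices n (F : seq bool -> seq bool -> algC) :
  \sum_(es : n.+1.-tuple bool | nth false es 0 == false)
     \sum_(js : n.+1.-tuple bool | compat es js) F es js
  = choice_sum n (fun es js => F (false :: es) (false :: js)
                             + F (false :: es) (true :: js)).
Proof.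
rewrite (@big_tuple_cons _ _ n (fun es => nth false es 0 == false)
  (fun es => \sum_(js : n.+1.-tuple bool | compat es js) F es js)).
rewrite big_bool /= big_pred0_eq add0r; apply: eq_bigr => es _.
rewrite (@big_tuple_cons _ _ n (compat (false :: es)) (F (false :: es))).
by rewrite big_bool /= big_split addrC.
Qed.

(** The first gap includes [y = 0], so only the two boundary terms occur there:
    this is the restriction [e_1 = 0]. *)
Lemma harm_sum_branch d n l0 e0 (ls : n.-tuple nat) (es : n.-tuple algC)
    (ks : n.-tuple nat) h :
  {in e0 :: es, forall e, (e != 0) && (e^-1 != 1)} ->
  (sumn (l0 :: ls) < d)%N -> (0 < h)%N ->
  harm_sum [tuple of l0 :: ls] [tuple of e0 :: es] (ks : (n.+1).-1.-tuple nat) h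
  = \sum_(e : n.+1.-tuple bool | nth false e 0 == false)
     \sum_(j : n.+1.-tuple bool | compat e j)
       branch_term d (0%N :: ks) (l0 :: ls) (map GRing.inv (e0 :: es)) h 0 e j.
Proof.
move=> esP ld h0.
have es0 : {in es, forall e, e != 0}.
  by move=> e ees; have := esP e; rewrite inE ees orbT => /(_ isT)/andP[].
have xs1 : {in map GRing.inv es, forall x, x != 1}.
  by move=> _ /mapP[e ees ->]; have := esP e; rewrite inE ees orbT => /(_ isT)/andP[].
have x1 : e0^-1 != 1 by have := esP e0; rewrite inE eqxx => /(_ isT)/andP[].
rewrite harm_sumE // (big_root_choices n (branch_term d (0%N :: ks) (l0 :: ls)
    (map GRing.inv (e0 :: es)) h 0)).
under eq_bigr => y _ do rewrite (@gap_sum_branch d n) ?size_map ?size_tuple //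
  ?(leq_ltn_trans _ ld) ?leq_addl // !choice_sumM.
rewrite choice_sum_nat; apply: eq_choice_sum => e j.
set x := e0^-1 in x1 *; set xs := map _ es.
pose f := 'X^l0 * branch d ks ls xs e j h.
have sf : (size f <= d)%N.
  apply: leq_trans (size_polyMleq _ _) _; rewrite size_polyXn addSn /=.
  by apply: leq_trans ld; rewrite -(addnS l0 (sumn ls)) leq_add2l size_branch.
pose c := (-1) ^+ sign_exponent e j * branch_char ks xs j ^+ h.
transitivity (c * \sum_(0 <= y < h) x ^+ y * f.[0 + y%:R]).
  rewrite mulr_sumr; apply: eq_bigr => y _.
  rewrite /branch_term -/c /f add0r hornerM hornerXn [RHS]mulrCA; congr (_ * _).
  by rewrite [RHS]mulrCA.
rewrite (geom_sum _ _ x1 sf) /branch_term /= -/xs -/x -/f.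
rewrite !horner_shift mul0n mul1n !add0r ?addr0 !expr0 expr1 mul1r !exprMn /c exprS.
ring.
Qed.

(** * Uniqueness of the coefficients of quasi-polynomials *)

Definition Qmu c : {pred algC} := fun x => `[< in_Qmu c x >].

Lemma QmuP c x : reflect (in_Qmu c x) (x \in Qmu c).
Proof. exact: asboolP. Qed.

Fact Qmu_divring_closed c : divring_closed (Qmu c).
Proof.
split=> [|x y /QmuP xQ /QmuP yQ|x y /QmuP xQ /QmuP yQ]; apply/QmuP => K KP Kmu;
  have [K1 KB KV] := KP => //.
- by apply: KB; [exact: xQ | exact: yQ].
by apply: KV; [exact: xQ | exact: yQ].
Qed.

HB.instance Definition _ c :=
  GRing.isDivringClosed.Build algC (Qmu c) (Qmu_divring_closed c).

Lemma mu_Qmu c : {subset mu c <= Qmu c}.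
Proof. by move=> x xmu; apply/QmuP => K _; apply. Qed.

Lemma mu_expX c (x : algC) h m : c.-unity_root x -> x ^+ (c * m + h) = x ^+ h.
Proof. by move/unity_rootP => xc; rewrite exprD exprM xc expr1n mul1r. Qed.

(** On each class of [h] modulo [c] the sum is a polynomial in [h] with
    infinitely many zeros, so all the moments [\sum_z A j z * z^b] vanish.  Hence
    so does [\sum_z A j z * p.[z]] for every polynomial [p]; take for [p] the one
    that vanishes on all of [mu c] except [x]. *)
Lemma quasi_poly_eq0 c D (A : nat -> algC -> algC) : (0 < c)%N ->
  (forall h, (0 < h)%N ->
     \sum_(0 <= j < D) \sum_(x <- mu c) A j x * h%:R ^+ j * x ^+ h = 0) ->
  forall j x, (j < D)%N -> x \in mu c -> A j x = 0.
Proof.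
move=> c0 A0 j x jD xmu.
have mom b : \sum_(z <- mu c) A j z * z ^+ b = 0.
  pose q : {poly algC} := \poly_(i < D) \sum_(z <- mu c) A i z * z ^+ b.
  suff q0 : q = 0.
    by have := coef_poly D (fun i => \sum_(z <- mu c) A i z * z ^+ b) j;
       rewrite -/q q0 coef0 jD => /esym.
  pose rs : seq algC := [seq (c * m.+1 + b)%:R | m <- iota 0 D].
  apply: (@roots_geq_poly_eq0 _ q rs); last by rewrite size_map size_iota size_poly.
    apply/allP => _ /mapP[m _ ->]; apply/rootP; rewrite horner_poly.
    rewrite -[RHS](A0 (c * m.+1 + b)%N); last by rewrite mulnS -addnA ltn_addr.
    rewrite big_mkord; apply: eq_bigr => i _; rewrite mulr_suml.
    rewrite [LHS]big_seq [RHS]big_seq; apply: eq_bigr => z zmu.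
    by rewrite mu_expX -?mem_mu // mulrAC.
  rewrite map_inj_in_uniq ?iota_uniq // => m1 m2 _ _ /eqP.
  by rewrite eqr_nat eqn_add2r eqn_pmul2l // eqSS => /eqP.
pose p : {poly algC} := \prod_(z <- rem x (mu c)) ('X - z%:P).
have umu := mu_uniq c0.
have px : p.[x] != 0.
  by rewrite -[_ == 0]/(root p x) root_prod_XsubC mem_rem_uniqF.
have pz z : z \in mu c -> z != x -> p.[z] = 0.
  move=> zmu zx; apply/eqP; rewrite -[_ == 0]/(root p z) root_prod_XsubC.
  by rewrite mem_rem_uniq // inE /= zx.
have: \sum_(z <- mu c) A j z * p.[z] = 0.
  under eq_bigr => z _ do rewrite horner_coef mulr_sumr.
  rewrite exchange_big big1 // => i _ /=.
  under eq_bigr => z _ do rewrite mulrCA.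
  by rewrite -mulr_sumr mom mulr0.
rewrite (bigD1_seq x) //= big_seq_cond big1 ?addr0 => [/eqP|z /andP[zmu zx]].
  by rewrite mulf_eq0 (negbTE px) orbF => /eqP.
by rewrite pz ?mulr0.
Qed.

(** An expansion of the harmonic sum exhibits explicit coefficients with the
    property [is_CMBN]; by uniqueness these are the ones that [CMBN] selects. *)
Lemma CMBN0E c r (l : r.-tuple nat) (eps : r.-tuple algC)
    (kappa : r.-1.-tuple nat) (I : finType) (P : pred I)
    (s t : I -> algC) (w : I -> {poly algC}) : (0 < c)%N ->
  (forall i, P i -> s i \in Qmu c) ->
  (forall i, P i -> t i \in mu c) ->
  (forall i, P i -> w i \is a polyOver (Qmu c)) ->
  (forall i, P i -> (size (w i) <= (sumn l + r).+1)%N) ->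
  (forall h, (0 < h)%N ->
    harm_sum l eps kappa h = \sum_(i | P i) s i * t i ^+ h * (w i).[h%:R]) ->
  forall x, x \in mu c ->
  CMBN c l eps kappa 0 x = \sum_(i | P i) s i * (w i)`_0 * (x == t i)%:R.
Proof.
move=> c0 sQ tmu wQ ws hE x xmu; set D := (sumn l + r).+1 in ws *.
pose B j z := \sum_(i | P i) s i * (w i)`_j * (z == t i)%:R.
have BP : is_CMBN c l eps kappa B.
  split=> [j z _ zmu|h h0].
    apply/QmuP/rpred_sum => i Pi; rewrite rpredM ?rpred_nat // rpredM ?sQ //.
    exact: (polyOverP (wQ _ Pi)).
  rewrite hE // -/D /B.
  under [RHS]eq_bigr => j _ do under eq_bigr => z _ do rewrite !mulr_suml.
  under [RHS]eq_bigr => j _ do rewrite exchange_big.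
  rewrite exchange_big; apply: eq_bigr => i Pi /=.
  rewrite (@horner_coef_wide _ D) ?ws // mulr_sumr big_mkord.
  apply: eq_bigr => j _; rewrite (bigD1_seq (t i)) ?tmu ?mu_uniq //=.
  rewrite big1 ?addr0 => [|z /negbTE ->]; last by rewrite mulr0 !mul0r.
  by rewrite eqxx mulr1 -!mulrA; congr (_ * _); rewrite mulrC -!mulrA.
rewrite /CMBN; case: pselect => [ex|[]]; last by exists B.
case: (cid ex) => C [_ CE] /=; case: BP => _ BE.
apply/eqP; rewrite -subr_eq0; apply/eqP.
apply: (@quasi_poly_eq0 c D (fun j z => C j z - B j z)) => // h h0.
under eq_bigr => j _ do under eq_bigr => z _ do rewrite !mulrBl.
under eq_bigr => j _ do rewrite sumrB.
by rewrite sumrB -CE // -BE // subrr.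
Qed.

(** * Branches at zero *)

Lemma size_ocirc_from (V W : nmodType) (a : V) (b : W) es s s' :
  size s = size s' -> size (ocirc_from a es s) = size (ocirc_from b es s').
Proof.
elim: es s s' a b => [|[] es IH] [|x s] [|y s'] a b //= [sz]; first exact: IH.
by congr _.+1; apply: IH.
Qed.

Lemma sumn_ocirc_from a es s :
  size s = size es -> sumn (ocirc_from a es s) = (a + sumn s)%N.
Proof.
elim: es s a => [|e es IH] [|x s] a //= [sz].
by case: e => /=; rewrite IH // addnA.
Qed.

Lemma shift0 (R : fieldType) (f : {poly R}) : shift 0 f = f.
Proof. by rewrite /shift addr0 comp_polyXr. Qed.

(** The entries at the positions that start a block, and 0 elsewhere, so that the
    block sums computed by [ocirc] are the entries heading the blocks. *)
Definition head_entries (xs : seq algC) (es : seq bool) : seq algC :=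
  [seq p.1 * (1 - nat_of_bool p.2)%N%:R | p <- zip xs es].

Lemma ocirc_from_head_entries (P : pred algC) x xs es :
  P x -> all P xs -> all P (ocirc_from x es (head_entries xs es)).
Proof.
elim: es xs x => [|e es IH] [|y xs] x //= Px; rewrite ?Px // => /andP[Py Pxs].
rewrite /head_entries; case: e => /=; first by rewrite mulr0 addr0; apply: IH.
by rewrite mulr1 Px; apply: IH.
Qed.

(** [a] and [x] are the sum of the exponents and the entry of the block being
    built: an index with [e = true] multiplies by a further power of ['X] under
    the same operator, and one with [e = false] opens the next block. *)
Lemma branch0_twist_poly d n a x ks ls xs es js :
  size ks = n -> size ls = n -> size xs = n -> size es = n -> size js = n ->
  shift_op (geom_poly d x) ('X^a * branch d ks ls xs es js 0)
    = twist_poly d (ocirc_from a es ls) (ocirc_from x es (head_entries xs es)).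
Proof.
elim: n a x ks ls xs es js => [|n IH] a x [|k ks] [|l ls] [|y xs] [|e es] [|j js] //=.
move=> [szk] [szl] [szx] [sze] [szj].
rewrite muln0 shift0 /head_entries; case: e => /=.
  by rewrite mulr0 addr0 mulrA -exprD (IH _ _ ks _ _ _ js).
by rewrite mulr1 (IH _ _ ks _ _ _ js).
Qed.

Lemma TMBN_branch d n l0 x0 k0 j0 ks ls xs es js :
  size ks = n -> size ls = n -> size xs = n -> size es = n -> size js = n ->
  all (fun x => x != 1) (x0 :: xs) -> (sumn (l0 :: ls) < d)%N ->
  TMBN (ocirc (false :: es) (l0 :: ls))
       (ocirc (false :: es) (head_entries (x0 :: xs) (false :: es)))
  = (branch d (k0 :: ks) (l0 :: ls) (x0 :: xs) (false :: es) (j0 :: js) 0).[0].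
Proof.
move=> szk szl szx sze szj /= /andP[x01 xs1] ld.
rewrite muln0 shift0 mulr1 -/(head_entries xs es) (@branch0_twist_poly d n) //.
apply: TMBN_twist; last by rewrite sumn_ocirc_from ?szl ?sze.
  by apply: size_ocirc_from; rewrite size_map size_zip szx sze minnn.
by apply/allP; apply: ocirc_from_head_entries.
Qed.

Lemma sign_exponentE n (es js : n.-tuple bool) :
  sign_exponent es js = (\sum_(k < n) (tnth es k + tnth js k))%N.
Proof.
transitivity (\sum_(k < n) (nth false es k + nth false js k))%N; last first.
  by apply: eq_bigr => k _; rewrite !(tnth_nth false).
elim: n es js => [|n IH] es js; first by rewrite big_ord0 (tuple0 es) (tuple0 js).
case/tupleP: es => e es; case/tupleP: js => j js.
by rewrite big_ord_recl /= IH.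
Qed.

Lemma branch_charE n (ks : seq nat) (xs : seq algC) (js : seq bool) :
  size ks = n -> size xs = n -> size js = n ->
  branch_char ks xs js
    = \prod_(k < n) xs`_k ^+ (nth 0%N ks k + nth false js k).
Proof.
elim: n ks xs js => [|n IH] [|k ks] [|x xs] [|j js] //=; first by rewrite big_ord0.
by move=> [szk] [szx] [szj]; rewrite big_ord_recl IH.
Qed.

Theorem corollary2p9 (p c r : nat) (p_prime : prime p) (c_ge2 : (2 <= c)%N)
    (cop : coprime c p) (r_gt0 : (0 < r)%N)
    (l : r.-tuple nat) (eps : r.-tuple algC) (kappa : r.-1.-tuple nat)
    (eps_mu : forall k : 'I_r, c.-unity_root (tnth eps k))
    (eps_neq1 : forall k : 'I_r, tnth eps k != 1)
    (xi : algC) (xi_mu : c.-unity_root xi) :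
  CMBN c l eps kappa 0 xi =
  \sum_(e : r.-tuple bool | nth false e 0 == false)
    \sum_(i : r.-tuple bool | [forall k : 'I_r, (tnth i k <= 1 - tnth e k)%N])
      (-1) ^+ (\sum_(k < r) (tnth e k + tnth i k))%N
      * TMBN (ocirc e l)
             (ocirc e [tuple (tnth eps k)^-1 * (1 - tnth e k)%:R | k < r])
      * (xi == \prod_(k < r)
                 (tnth eps k) ^- (nth 0%N (0%N :: kappa) k + tnth i k))%:R.
Proof.
case: r r_gt0 l eps kappa eps_mu eps_neq1 => // n _ l eps kappa eps_mu eps_neq1.
have c0 : (0 < c)%N by apply: ltnW.
have xmu : xi \in mu c by rewrite mem_mu.
pose xs := map GRing.inv eps; pose ks := 0%N :: kappa; pose d := (sumn l).+1.
have szks : size ks = n.+1 by rewrite /= size_tuple.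
have szxs : size xs = n.+1 by rewrite size_map size_tuple.
have epsP : {in eps, forall e, (e != 0) && (e^-1 != 1)}.
  move=> _ /tnthP[k ->]; rewrite invr_eq1 eps_neq1 andbT.
  apply/eqP => e0; have := eps_mu k; rewrite e0 => /unity_rootP/eqP.
  by rewrite expr0n gtn_eqF // eq_sym oner_eq0.
have xsmu : {subset xs <= mu c}.
  move=> _ /mapP[_ /tnthP[k ->] ->]; rewrite mem_mu //; apply/unity_rootP.
  by rewrite exprVn (unity_rootP (eps_mu k)) invr1.
pose T := (n.+1.-tuple bool * n.+1.-tuple bool)%type.
have /choice[w wP] (q : T) : exists w : {poly algC},
    [/\ w \is a polyOver (Qmu c), (size w <= d)%N
      & forall h, (branch d ks l xs q.1 q.2 h).[0] = w.[h%:R]].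
  apply: polyfam_value0; apply: polyfam_branch => x xxs.
  by apply: mu_Qmu; apply: xsmu.
pose s (q : T) : algC := (-1) ^+ sign_exponent q.1 q.2.
pose t (q : T) := branch_char ks xs q.2.
pose P (q : T) := (nth false q.1 0 == false) && compat q.1 q.2.
have tmu q : t q \in mu c.
  rewrite /t (@branch_charE n.+1) ?size_tuple // mem_mu //; apply/unity_rootP.
  rewrite -prodrXl big1 // => k _; rewrite exprAC.
  have : xs`_k \in mu c by apply/xsmu/mem_nth; rewrite szxs.
  by rewrite mem_mu // => /unity_rootP ->; rewrite expr1n.
rewrite (@CMBN0E c n.+1 l eps kappa _ P s t w) //; first last.
- move=> h h0; case/tupleP: l @d wP => l0 ls d wP.
  case/tupleP: eps eps_mu eps_neq1 @xs epsP szxs xsmu wP @t tmu => e0 es.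
  move=> _ _ xs epsP szxs xsmu wP t tmu.
  rewrite (@harm_sum_branch d n) // pair_big_dep; apply: eq_bigr => q _.
  by have [_ _ wE] := wP q; rewrite -wE.
- by move=> q _; have [_ /leq_trans-> //] := wP q; rewrite /d ltnS leq_addr.
- by move=> q _; have [] := wP q.
- by move=> q _; rewrite rpredX // rpredN rpred1.
rewrite [RHS]pair_big_dep /=; apply: eq_big => [[e j]|[e j] /andP[e0 _]] /=.
  by rewrite compatE.
rewrite /s sign_exponentE; congr (_ * _ * _); last first.
  congr (nat_of_bool (_ == _))%:R; rewrite /t (@branch_charE n.+1) ?size_tuple //.
  apply: eq_bigr => k _; rewrite (nth_map 0) ?size_tuple // (tnth_nth 0) exprVn.
  by rewrite (tnth_nth false).
have [_ _ wE] := wP (e, j); rewrite -horner_coef0 -[0]/(0%:R) -wE /=.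
rewrite -[RHS]/(TMBN _ _).
have -> : ocirc e [tuple (tnth eps k)^-1 * (1 - tnth e k)%:R | k < n.+1]
    = ocirc e (head_entries xs e).
  congr (ocirc _ _); apply: (@eq_from_nth _ 0) => [|i].
    by rewrite size_tuple /head_entries size_map size_zip szxs size_tuple minnn.
  rewrite size_tuple => i_n.
  transitivity (tnth [tuple (tnth eps k)^-1 * (1 - tnth e k)%:R | k < n.+1]
                     (Ordinal i_n)); first by rewrite (tnth_nth 0).
  rewrite tnth_mktuple !(tnth_nth 0, tnth_nth false) /=.
  rewrite /head_entries (nth_map (0, false)) ?size_zip ?szxs ?size_tuple ?minnn //.
  by rewrite nth_zip ?szxs ?size_tuple //= (nth_map 0) ?size_tuple.
case/tupleP: l @d wP wE => l0 ls d wP wE.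
case/tupleP: e e0 wE => e1 e; case/tupleP: j => j1 j /= /eqP -> _.
have xs1 : all (fun x => x != 1) xs.
  by apply/allP => _ /mapP[y yeps ->]; have /andP[] := epsP y yeps.
clear xsmu t tmu wP.
case: xs szxs xs1 => [|x0 xs'] // [szx] xs1.
by apply: esym; apply: (@TMBN_branch d n l0 x0 0%N j1 kappa ls xs' e j);
   rewrite ?size_tuple.
Qed.
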